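(* Let $a,b,e$ be integers with $b\ge 1$, $1\le e\le b$ and $a=2b+e$, and let $n\ge 0$. If $C_0,C_n$ are $n$-compatible good sets, then there exists an $(a,b)$-coloring $\varphi$ of the path $P^n$ with $\varphi(0)=C_0$ and $\varphi(n)=C_n$, and such a coloring can be computed in linear time.
   Context: An $(a,b)$-coloring of a graph assigns to each vertex a $b$-element subset of $\{1,\ldots,a\}$ so that adjacent vertices receive disjoint sets. $P^n$ is the path with vertex set $\{0,\ldots,n\}$ and edges $i(i+1)$. A good set is a $b$-element subset of $\{1,\ldots,a\}$. Two good sets $X,Y$ are $k$-compatible (for an integer $k$) if $|X\cap Y|\ge b-e\frac{k}{2}$ when $k$ is even, and $|X\cap Y|\le e\frac{k-1}{2}$ when $k$ is odd. *)

(* Defs.v *)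
From mathcomp Require Import all_boot all_order all_algebra.
Set Implicit Arguments.
Unset Strict Implicit.
Unset Printing Implicit Defensive.

(* The colour set {1, ..., a} is represented by 'I_a, the ordinal i standing
   for the colour i + 1. *)

Definition good (a b : nat) (X : {set 'I_a}) : Prop := #|X| = b.

Definition ab_coloring (T : finType) (adj : rel T) (a b : nat)
    (phi : T -> {set 'I_a}) : Prop :=
  (forall v, good b (phi v)) /\
  (forall u v, adj u v -> [disjoint phi u & phi v]).

Definition path_adj (n : nat) : rel 'I_n.+1 :=
  fun i j => (i.+1 == j :> nat) || (j.+1 == i :> nat).

(* The comparisons are made in int, so that b - e k / 2 may be negative. *)
Definition compatible (a b e : nat) (k : int) (X Y : {set 'I_a}) : Prop :=
  if (2 %| k)%Z
  then (b%:Z - e%:Z * (k %/ 2)%Z <= #|X :&: Y|%:Z)%R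
  else (#|X :&: Y|%:Z <= e%:Z * ((k - 1)%R %/ 2)%Z)%R.

(* Random access machine under the uniform cost criterion: finitely many
   registers are named by a program, the memory is addressed indirectly through
   registers, and the output tape is write-only. Each instruction and each
   evaluation of a test costs one time unit. *)

Inductive instr : Type :=
| Const (r k : nat)
| Add (r s t : nat)
| Sub (r s t : nat)
| Fetch (r s : nat)
| Store (r s : nat)
| Write (r : nat).

Inductive prog : Type :=
| Skip
| Do (i : instr)
| Seq (p q : prog)
| If (r : nat) (p q : prog)
| While (r : nat) (p : prog).

Record state : Type := State {
  reg : nat -> nat;
  mem : nat -> nat;
  out : seq nat
}.

Definition upd (f : nat -> nat) (x y : nat) : nat -> nat :=
  fun z => if z == x then y else f z.

Definition step (i : instr) (s : state) : state :=
  match i with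
  | Const r k => State (upd (reg s) r k) (mem s) (out s)
  | Add r x y => State (upd (reg s) r (reg s x + reg s y)) (mem s) (out s)
  (* truncated subtraction *)
  | Sub r x y => State (upd (reg s) r (reg s x - reg s y)) (mem s) (out s)
  | Fetch r x => State (upd (reg s) r (mem s (reg s x))) (mem s) (out s)
  | Store r x => State (reg s) (upd (mem s) (reg s r) (reg s x)) (out s)
  | Write r => State (reg s) (mem s) (rcons (out s) (reg s r))
  end.

(* [exec p s t s']: started in state s, p halts in state s' after t time units.
   A test on register r succeeds when r is nonzero. *)
Inductive exec : prog -> state -> nat -> state -> Prop :=
| ExecSkip s : exec Skip s 1 s
| ExecDo i s : exec (Do i) s 1 (step i s)
| ExecSeq p q s1 s2 s3 t1 t2 :
    exec p s1 t1 s2 -> exec q s2 t2 s3 -> exec (Seq p q) s1 (t1 + t2) s3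
| ExecIfT r p q s t s' :
    reg s r != 0 -> exec p s t s' -> exec (If r p q) s t.+1 s'
| ExecIfF r p q s t s' :
    reg s r = 0 -> exec q s t s' -> exec (If r p q) s t.+1 s'
| ExecWhileT r p s1 s2 s3 t1 t2 :
    reg s1 r != 0 -> exec p s1 t1 s2 -> exec (While r p) s2 t2 s3 ->
    exec (While r p) s1 (t1 + t2).+1 s3
| ExecWhileF r p s : reg s r = 0 -> exec (While r p) s 1 s.

(* The input word sequence occupies the memory cells from address 0 on. *)
Definition init (inp : seq nat) : state :=
  State (fun=> 0) (fun i => nth 0 inp i) [::].

Definition computes_within (p : prog) (inp outp : seq nat) (T : nat) : Prop :=
  exists t s, [/\ exec p (init inp) t s, out s = outp & t <= T].

(* Sets of colours are encoded by their characteristic vectors, one 0/1 word per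
   colour. *)
Definition charvec (a : nat) (X : {set 'I_a}) : seq nat :=
  [seq nat_of_bool (i \in X) | i <- enum 'I_a].

Definition encode_input (a b n : nat) (C0 Cn : {set 'I_a}) : seq nat :=
  [:: a; b; n] ++ charvec C0 ++ charvec Cn.

Definition encode_output (a n : nat) (phi : 'I_n.+1 -> {set 'I_a}) : seq nat :=
  flatten [seq charvec (phi i) | i <- enum 'I_n.+1].

(* Main.v *)
(** The path is coloured from left to right.  With [k] edges left and the
    current set [X], the next set [Z] takes [b] colours outside [X]: those of
    the target [Y] first when [k] is odd, those outside [Y] first when [k] is
    even.  Since [X] misses [b + e] colours, [Z] meets [Y] in at least
    [b - |X :&: Y|] colours in the first case and in at most
    [max 0 (b - e - |X :&: Y|)] in the second, so that [Z] and [Y] are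
    [k - 1]-compatible; at [k = 0] this says that the set reached is [Y].  On
    the characteristic vector of [X] each step is done in place by two scans,
    because how many colours the second choice may use is known only once the
    first one is complete. *)

Require Import Defs.
From mathcomp Require Import all_boot all_order all_algebra.
From mathcomp Require Import zify.

Set Implicit Arguments.
Unset Strict Implicit.
Unset Printing Implicit Defensive.

(** * Compatibility along greedy successors *)

Definition preferred (T : finType) (p : bool) (Y : {set T}) : {set T} :=
  if p then Y else ~: Y.

Lemma in_preferred (T : finType) p (Y : {set T}) i :
  (i \in preferred p Y) = ((i \in Y) == p).
Proof. by case: p; rewrite /preferred ?inE ?eqb_id ?eqbF_neg. Qed.

Definition greedy_successor (T : finType) (P X Z : {set T}) : Prop :=
  [/\ [disjoint X & Z], #|Z| = #|X| & minn #|X| #|P :\: X| <= #|P :&: Z|].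

Section GreedySuccessor.

Variables (T : finType) (X Y Z : {set T}).

Lemma greedy_successor_meet_ge :
  greedy_successor Y X Z -> #|Y| <= #|X| -> #|Y| <= #|Z :&: Y| + #|X :&: Y|.
Proof.
case=> _ _; rewrite [Z :&: Y]setIC [X :&: Y]setIC.
by have := cardsID X Y; lia.
Qed.

Lemma greedy_successor_meet_le :
  greedy_successor (~: Y) X Z ->
  #|Z :&: Y| + minn #|X| #|~: (X :|: Y)| <= #|X|.
Proof.
case=> _ ZX; rewrite setDE -setCU [Y :|: X]setUC [~: Y :&: Z]setIC -setDE.
by have := cardsID Y Z; lia.
Qed.

End GreedySuccessor.

Definition compatible_nat (T : finType) (b e k : nat) (X Y : {set T}) : bool :=
  if odd k then #|X :&: Y| <= e * k./2 else b <= #|X :&: Y| + e * k./2.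

Lemma compatible_to_nat (a b e k : nat) (X Y : {set 'I_a}) :
  compatible b e k%:Z X Y -> compatible_nat b e k X Y.
Proof.
rewrite /compatible /compatible_nat.
have -> : (2 %| k%:Z)%Z = ~~ odd k by rewrite -dvdn2.
have := odd_double_half k; case: (odd k) => /= def_k.
- have -> : (((k%:Z - 1) %/ 2)%Z = k./2%:Z)%R by lia.
  by rewrite -PoszM lez_nat.
- have -> : ((k%:Z %/ 2)%Z = k./2%:Z)%R by lia.
  by rewrite -PoszM; move: (e * _); lia.
Qed.

Section GreedyChain.

Variables (T : finType) (b e : nat) (Y : {set T}).
Hypotheses (card_T : #|T| = 2 * b + e) (card_Y : #|Y| = b).

Lemma compatible_nat0_eq (X : {set T}) :
  #|X| = b -> compatible_nat b e 0 X Y -> X = Y.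
Proof.
rewrite /compatible_nat muln0 addn0 => card_X le_b.
have XY_X : X :&: Y = X by apply/eqP; rewrite eqEcard subsetIl card_X.
by apply/eqP; rewrite eqEcard card_X card_Y leqnn andbT; apply/setIidPl.
Qed.

Lemma compatible_greedy_successor k (X Z : {set T}) :
  #|X| = b -> greedy_successor (preferred (odd k.+1) Y) X Z ->
  compatible_nat b e k.+1 X Y -> compatible_nat b e k Z Y.
Proof.
rewrite /compatible_nat /= uphalf_half => card_X.
case: (odd k) => /= succZ; rewrite ?add0n ?add1n ?mulnS; move: (e * _) => m.
- have := greedy_successor_meet_le succZ; have := cardsC (X :|: Y).
  by have := cardsUI X Y; lia.
- by have := greedy_successor_meet_ge succZ; lia.
Qed.

Lemma compatible_greedy_chain n (X : nat -> {set T}) :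
  #|X 0| = b -> compatible_nat b e n (X 0) Y ->
  (forall i, i < n ->
     greedy_successor (preferred (odd (n - i)) Y) (X i) (X i.+1)) ->
  X n = Y.
Proof.
move=> card_X0 X0Y succX.
have chain i : i <= n -> #|X i| = b /\ compatible_nat b e (n - i) (X i) Y.
  elim: i => [|i IHi] lt_in; first by rewrite subn0.
  have [card_Xi XiY] := IHi (ltnW lt_in).
  have := succX i lt_in; rewrite -subnSK // in XiY * => succXi.
  split; last exact: compatible_greedy_successor succXi XiY.
  by case: succXi => _ -> _.
by have [] := chain n (leqnn n); rewrite subnn; apply: compatible_nat0_eq.
Qed.

End GreedyChain.

(** * The greedy successor *)

Section Smallest.

Variable a : nat.
Implicit Type A : {set 'I_a}.

Definition below (m : nat) : {set 'I_a} := [set i : 'I_a | i < m].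

Lemma setI_below0 A : A :&: below 0 = set0.
Proof. by apply/setP=> i; rewrite !inE andbF. Qed.

Lemma setI_below A : A :&: below a = A.
Proof. by apply/setP=> i; rewrite !inE ltn_ord andbT. Qed.

Lemma in_setI_belowx A (i : 'I_a) : (i \in A :&: below i) = false.
Proof. by rewrite !inE ltnn andbF. Qed.

Lemma in_setI_belowS A (i j : 'I_a) :
  (j \in A :&: below i.+1) = if j == i then i \in A else j \in A :&: below i.
Proof.
rewrite !inE ltnS leq_eqVlt -val_eqE /=.
by case: eqP => [/val_inj -> | _]; rewrite ?andbT.
Qed.

Lemma card_setI_belowS A (i : 'I_a) :
  #|A :&: below i.+1| = (i \in A) + #|A :&: below i|.
Proof.
rewrite (cardsD1 i) in_setI_belowS eqxx; congr (_ + #|pred_of_set _|).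
apply/setP=> j; rewrite in_setD1 in_setI_belowS.
by case: eqP => // ->; rewrite in_setI_belowx.
Qed.

Definition smallest (c : nat) A : {set 'I_a} :=
  [set i in A | #|A :&: below i| < c].

Lemma in_smallest c A i :
  (i \in smallest c A) = (i \in A) && (#|A :&: below i| < c).
Proof. by rewrite inE. Qed.

Lemma subn_card_belowS c A (i : 'I_a) :
  c - #|A :&: below i.+1| = c - #|A :&: below i| - (i \in smallest c A).
Proof. by rewrite card_setI_belowS in_smallest; case: (i \in A) => /=; lia. Qed.

Lemma card_smallest c A : #|smallest c A| = minn c #|A|.
Proof.
suff: forall m, m <= a -> #|smallest c A :&: below m| = minn c #|A :&: below m|.
  by move/(_ a (leqnn a)); rewrite !setI_below.
elim=> [|m IHm] lt_ma; first by rewrite !setI_below0 cards0 minn0.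
have := IHm (ltnW lt_ma); rewrite -[m]/(val (Ordinal lt_ma)) !card_setI_belowS.
by rewrite in_smallest; case: (_ \in A) => /=; lia.
Qed.

End Smallest.

Section GreedyNext.

Variables (a b : nat) (P X : {set 'I_a}).

Definition chosen_first : {set 'I_a} := smallest b (P :\: X).

Definition unchosen : {set 'I_a} := ~: X :\: chosen_first.

Definition chosen_last : {set 'I_a} := smallest (b - #|P :\: X|) unchosen.

Definition greedy_next : {set 'I_a} := chosen_first :|: chosen_last.

Lemma in_chosen_first i :
  (i \in chosen_first) =
  [&& i \notin X, i \in P & #|(P :\: X) :&: below a i| < b].
Proof. by rewrite in_smallest in_setD andbA. Qed.

Lemma chosen_firstNX i : i \in chosen_first -> i \notin X.
Proof. by rewrite in_chosen_first => /andP[]. Qed.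

Lemma disjoint_greedy_next : [disjoint X & greedy_next].
Proof.
apply/pred0P => i /=; rewrite /greedy_next in_setU.
case iX: (i \in X) => //=; apply/norP; split.
- by apply/negP => /chosen_firstNX; rewrite iX.
- by rewrite !inE iX andbF.
Qed.

Lemma card_greedy_next : #|X| + b <= a -> #|greedy_next| = b.
Proof.
rewrite -[leqRHS]card_ord -(cardsC X) leq_add2l => le_b.
have : [disjoint chosen_first & chosen_last].
  by apply/pred0P => i /=; rewrite !inE; case: (_ && (_ < b)).
rewrite -leq_card_setU => /eqP ->.
have := cardsID chosen_first (~: X).
have /setIidPr -> : chosen_first \subset ~: X.
  by apply/subsetP=> i /chosen_firstNX; rewrite inE.
by rewrite !card_smallest -/unchosen; lia.
Qed.

Lemma greedy_nextP :
  #|X| = b -> 2 * b <= a -> greedy_successor P X greedy_next.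
Proof.
move=> card_X le_2b; split; first exact: disjoint_greedy_next.
  by rewrite card_greedy_next card_X // addnn -mul2n.
rewrite card_X -card_smallest subset_leq_card //.
apply/subsetP=> i i_first; rewrite in_setI in_setU i_first andbT.
by move: i_first; rewrite in_chosen_first => /and3P[].
Qed.

End GreedyNext.

Section GreedyWalk.

Variables (a b n : nat) (X Y : {set 'I_a}).

Fixpoint greedy_walk (i : nat) : {set 'I_a} :=
  if i is j.+1
  then greedy_next b (preferred (odd (n - j)) Y) (greedy_walk j)
  else X.

Definition greedy_coloring (i : 'I_n.+1) : {set 'I_a} := greedy_walk i.

Lemma card_greedy_walk i : 2 * b <= a -> #|X| = b -> #|greedy_walk i| = b.
Proof.
move=> le_2b card_X; elim: i => //= i card_i.
by rewrite card_greedy_next // card_i addnn -mul2n.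
Qed.

Lemma greedy_walk_successor i : 2 * b <= a -> #|X| = b ->
  greedy_successor (preferred (odd (n - i)) Y)
    (greedy_walk i) (greedy_walk i.+1).
Proof.
move=> le_2b card_X.
exact: greedy_nextP (card_greedy_walk i le_2b card_X) le_2b.
Qed.

Lemma greedy_coloring_ab :
  2 * b <= a -> #|X| = b -> ab_coloring (@path_adj n) b greedy_coloring.
Proof.
move=> le_2b card_X; split=> [i|i j]; first exact: card_greedy_walk.
have disjointS l : [disjoint greedy_walk l & greedy_walk l.+1].
  by have [] := greedy_walk_successor l le_2b card_X.
by case/orP=> /eqP ij; rewrite /greedy_coloring -ij // disjoint_sym.
Qed.

Lemma greedy_coloring_max e :
  a = 2 * b + e -> #|X| = b -> #|Y| = b -> compatible b e n%:Z X Y ->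
  greedy_coloring ord_max = Y.
Proof.
move=> def_a card_X card_Y /compatible_to_nat XY.
have card_a : #|'I_a| = 2 * b + e by rewrite card_ord.
apply: (compatible_greedy_chain card_a card_Y _ XY) => // i _.
by apply: greedy_walk_successor; rewrite // def_a leq_addr.
Qed.

Lemma greedy_coloringP e :
  a = 2 * b + e -> good b X -> good b Y -> compatible b e n%:Z X Y ->
  [/\ ab_coloring (@path_adj n) b greedy_coloring,
      greedy_coloring ord0 = X & greedy_coloring ord_max = Y].
Proof.
move=> def_a X_good Y_good XY; split=> //; last exact: greedy_coloring_max XY.
by apply: greedy_coloring_ab; rewrite // def_a leq_addr.
Qed.

End GreedyWalk.

Arguments greedy_coloring {a} b n X Y i.

(** * Timed Hoare triples *)

Definition triple (P : state -> Prop) (p : prog) (T : nat) (Q : state -> Prop) :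
    Prop :=
  forall s, P s -> exists t s', [/\ exec p s t s', t <= T & Q s'].

Lemma triple_conseq (P P' Q Q' : state -> Prop) p T :
  (forall s, P s -> P' s) -> (forall s, Q' s -> Q s) ->
  triple P' p T Q' -> triple P p T Q.
Proof.
move=> PP' Q'Q p_ok s /PP'/p_ok[t [s' [exec_p le_t /Q'Q Qs']]].
by exists t, s'.
Qed.

Lemma triple_seq P Q R p q T U :
  triple P p T Q -> triple Q q U R -> triple P (Seq p q) (T + U) R.
Proof.
move=> p_ok q_ok s /p_ok[t [s' [exec_p le_t Qs']]].
have [u [s'' [exec_q le_u Rs'']]] := q_ok s' Qs'.
by exists (t + u), s''; split=> //; [apply: ExecSeq exec_q | apply: leq_add].
Qed.

(* [While] is not interpreted: [run] is meant for loop-free programs. *)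
Fixpoint run (p : prog) (s : state) : state :=
  match p with
  | Do i => step i s
  | Seq p q => run q (run p s)
  | If r p q => if reg s r != 0 then run p s else run q s
  | _ => s
  end.

Fixpoint loop_free (p : prog) : bool :=
  match p with
  | Seq p q | If _ p q => loop_free p && loop_free q
  | While _ _ => false
  | _ => true
  end.

Fixpoint cost (p : prog) : nat :=
  match p with
  | Seq p q => cost p + cost q
  | If _ p q => (maxn (cost p) (cost q)).+1
  | _ => 1
  end.

Lemma exec_run p s :
  loop_free p -> exists2 t, exec p s t (run p s) & t <= cost p.
Proof.
elim: p s => [|i|p IHp q IHq|r p IHp q IHq|] s //=.
- by exists 1 => //; apply: ExecSkip.
- by exists 1 => //; apply: ExecDo.
- case/andP=> /(IHp s)[t exec_p le_t] /(IHq (run p s))[u exec_q le_u].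
  by exists (t + u); [apply: ExecSeq exec_q | apply: leq_add].
- case/andP=> /(IHp s)[t exec_p le_t] /(IHq s)[u exec_q le_u].
  case: eqVneq => [reg_r|reg_r] /=.
    by exists u.+1; [apply: ExecIfF | lia].
  by exists t.+1; [apply: ExecIfT | lia].
Qed.

Lemma triple_run (P Q : state -> Prop) p :
  loop_free p -> (forall s, P s -> Q (run p s)) -> triple P p (cost p) Q.
Proof.
move=> p_loop_free PQ s Ps; have [t exec_p le_t] := exec_run s p_loop_free.
by exists t, (run p s); split=> //; apply: PQ.
Qed.

Definition while_cost (k T : nat) : nat := (k * T.+1).+1.

Lemma triple_while (I : nat -> state -> Prop) r p T k :
  (forall m s, m <= k -> I m s -> reg s r = m) ->
  (forall m, m < k -> triple (I m.+1) p T (I m)) ->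
  triple (I k) (While r p) (while_cost k T) (I 0).
Proof.
rewrite /while_cost; elim: k => [|k IHk] Ir body_ok s Is.
  by exists 1, s; split=> //; apply: ExecWhileF; apply: Ir Is.
have [t [s' [exec_body le_t]]] := body_ok k (ltnSn k) s Is.
case/IHk=> [m s1 /leqW|m /ltnW|u [s'' [exec_loop le_u I0]]].
- exact: Ir.
- exact: body_ok.
exists (t + u).+1, s''; split=> //; last by rewrite mulSn; lia.
by apply: ExecWhileT exec_body exec_loop; rewrite (Ir _ _ _ Is).
Qed.

(** * The program *)

(* Cells 0, 1, 2 hold [a], [b], [n].  The [a] cells from address 3 on hold the
   current set, and the following [a] cells the target.  [rTodo] counts the sets
   still to be written, [rPref] tells whether colours of the target come first,
   and [rBudget] counts the colours still to be chosen in the current pass. *)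
Definition rA : nat := 0.
Definition rB : nat := 1.
Definition rTodo : nat := 2.
Definition rOne : nat := 3.
Definition rPref : nat := 4.
Definition rBudget : nat := 5.
Definition rCount : nat := 6.
Definition rAddr : nat := 7.
Definition rCell : nat := 8.
Definition rAddrY : nat := 9.
Definition rCellY : nat := 10.

Local Coercion Do : instr >-> prog.
Local Notation "p ;; q" := (Seq p q) (at level 60, right associativity).

Definition copy (r s : nat) : prog := Const r 0 ;; Add r r s.

Definition decr (r : nat) : prog := Defs.Sub r r rOne.

Definition first_cell : prog := copy rCount rA ;; Const rAddr 3.

Definition next_cell : prog := Add rAddr rAddr rOne ;; decr rCount.

Definition scan (body : prog) : prog :=
  first_cell ;; While rCount (body ;; next_cell).

Definition load_cells : prog :=
  Fetch rCell rAddr ;; Write rCell ;;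
  Add rAddrY rAddr rA ;; Fetch rCellY rAddrY.

(* The mark 2 keeps a colour chosen for the next set apart from those of the
   current set, which it must still avoid in the second scan. *)
Definition mark_cell : prog :=
  Const rCell 2 ;; Store rAddr rCell ;; decr rBudget.

Definition mark_if_preferred : prog :=
  If rCell Skip
    (If rBudget
       (If rCellY (If rPref mark_cell Skip) (If rPref Skip mark_cell))
       Skip).

Definition emit_and_mark : prog := load_cells ;; mark_if_preferred.

Definition choose_cell : prog :=
  If rCell (decr rCell) (If rBudget (Const rCell 1 ;; decr rBudget) Skip).

Definition update_cell : prog :=
  Fetch rCell rAddr ;; choose_cell ;; Store rAddr rCell.

Definition flip_pref : prog := Defs.Sub rPref rOne rPref.

Definition mark_pass : prog :=
  copy rBudget rB ;; scan emit_and_mark.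

Definition update_pass : prog := scan update_cell.

Definition advance : prog := flip_pref ;; decr rTodo.

Definition walk_step : prog := mark_pass ;; update_pass ;; advance.

Definition parity_step : prog := flip_pref ;; decr rCount.

Definition setup : prog :=
  Const rOne 1 ;;
  (Const rAddr 0 ;; Fetch rA rAddr) ;; (Const rAddr 1 ;; Fetch rB rAddr) ;;
  (Const rAddr 2 ;; Fetch rTodo rAddr ;; Add rTodo rTodo rOne) ;;
  Const rPref 1 ;; copy rCount rTodo.

Definition coloring_prog : prog :=
  setup ;; While rCount parity_step ;; While rTodo walk_step.

(** * Correctness and running time *)

Section CharacteristicVectors.

Variable a : nat.
Implicit Types (A X : {set 'I_a}) (i : 'I_a).

Definition bits A i : nat := i \in A.

Definition marked_bits X A i : nat := if i \in A then 2 else bits X i.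

Lemma size_charvec A : size (charvec A) = a.
Proof. by rewrite size_map size_enum_ord. Qed.

Lemma nth_charvec A i : nth 0 (charvec A) i = bits A i.
Proof. by rewrite (nth_map i) ?nth_ord_enum // size_enum_ord. Qed.

End CharacteristicVectors.

Definition array (a : nat) (s : state) (base : nat) (f : 'I_a -> nat) : Prop :=
  forall i : 'I_a, Defs.mem s (base + i) = f i.

Section Configurations.

Variables (a b : nat) (Y : {set 'I_a}).

Record config (todo : nat) (pref : bool) (budget : nat) (current : 'I_a -> nat)
    (written : seq nat) (s : state) : Prop := Config {
  config_a : reg s rA = a;
  config_b : reg s rB = b;
  config_todo : reg s rTodo = todo;
  config_one : reg s rOne = 1;
  config_pref : reg s rPref = pref;
  config_budget : reg s rBudget = budget;
  config_current : array s 3 current;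
  config_target : array s (3 + a) (bits Y);
  config_out : out s = written
}.

Section Updates.

Variables (k : nat) (p : bool) (c : nat) (f : 'I_a -> nat) (o : seq nat).
Variable s : state.
Hypothesis conf_s : config k p c f o s.

Lemma eq_config g : f =1 g -> config k p c g o s.
Proof. by case: conf_s => *; split=> // i; rewrite -(_ : f i = g i). Qed.

Lemma config_upd r v : r \notin [:: rA; rB; rTodo; rOne; rPref; rBudget] ->
  config k p c f o (State (upd (reg s) r v) (Defs.mem s) (out s)).
Proof.
rewrite !inE => /norP[? /norP[? /norP[? /norP[? /norP[? ?]]]]].
by case: conf_s => *; split=> //=; rewrite /upd ifN // eq_sym.
Qed.

Lemma config_upd_budget v :
  config k p v f o (State (upd (reg s) rBudget v) (Defs.mem s) (out s)).
Proof. by case: conf_s. Qed.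

Lemma config_decr_budget : config k p (c - 1) f o (run (decr rBudget) s).
Proof.
rewrite -(config_budget conf_s) -(config_one conf_s).
exact: config_upd_budget.
Qed.

Lemma config_store r (i : 'I_a) : reg s rAddr = 3 + i ->
  config k p c (fun j => if j == i then reg s r else f j) o
    (step (Store rAddr r) s).
Proof.
case: conf_s => *; split=> // j; rewrite /= /upd (_ : reg s rAddr = 3 + i) //.
- by rewrite eqn_add2l -[in RHS]val_eqE; case: eqP.
- by rewrite ifN //; have := ltn_ord i; lia.
Qed.

Lemma config_write r :
  config k p c f (rcons o (reg s r)) (step (Write r) s).
Proof. by case: conf_s => *; split=> //=; congr rcons. Qed.

End Updates.

Section Scan.

Variables (k : nat) (p : bool).

Definition at_cell (c : nat) (f : 'I_a -> nat) (o : seq nat) (i m : nat)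
    (s : state) : Prop :=
  [/\ config k p c f o s, reg s rAddr = 3 + i & reg s rCount = m].

Definition scan_cost (T : nat) : nat :=
  cost first_cell + while_cost a (T + cost next_cell).

Lemma scanP (c : nat -> nat) (f : nat -> 'I_a -> nat) (o : nat -> seq nat)
    body T :
  (forall (i : 'I_a) m, triple (at_cell (c i) (f i) (o i) i m) body T
                          (at_cell (c i.+1) (f i.+1) (o i.+1) i m)) ->
  triple (config k p (c 0) (f 0) (o 0)) (scan body) (scan_cost T)
    (config k p (c a) (f a) (o a)).
Proof.
move=> body_ok.
pose I m s := let i := a - m in at_cell (c i) (f i) (o i) i m s.
apply: (@triple_seq _ (I a)).
  apply: triple_run => // s conf_s; rewrite /I subnn.
  split; [|by []|by rewrite /= /upd /= (config_a conf_s)].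
  by do 3![apply: config_upd => //].
apply: (@triple_conseq _ (I a) _ (I 0)) => // [s [+ _ _]|].
  by rewrite subn0.
apply: triple_while => [m s _ []//|m lt_ma].
have lt_ia : a - m.+1 < a by lia.
apply: triple_seq (body_ok (Ordinal lt_ia) m.+1) _.
rewrite /= subnSK //.
apply: triple_run => // s [conf_s addr_s count_s]; split.
- by do 2![apply: config_upd => //].
- by rewrite /= /upd /= addr_s (config_one conf_s); lia.
- by rewrite /= /upd /= count_s (config_one conf_s); lia.
Qed.

End Scan.

Section Passes.

Variables (k : nat) (p : bool) (X : {set 'I_a}) (o : seq nat).

Let P : {set 'I_a} := preferred p Y.
Let M : {set 'I_a} := chosen_first b P X.

Lemma fetch_cell c f w (i : 'I_a) m s : at_cell k p c f w i m s ->
  at_cell k p c f w i m (step (Fetch rCell rAddr) s) /\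
  reg (step (Fetch rCell rAddr) s) rCell = f i.
Proof.
case=> conf_s addr_s count_s; split; first by split=> //; apply: config_upd.
by rewrite /= /upd /= addr_s; apply: (config_current conf_s).
Qed.

Lemma run_load_cells c f w (i : 'I_a) m s : at_cell k p c f w i m s ->
  let s' := run load_cells s in
  [/\ at_cell k p c f (rcons w (f i)) i m s',
      reg s' rCell = f i & reg s' rCellY = bits Y i].
Proof.
move=> /fetch_cell[[conf_f addr_f count_f] cell_f]; split=> //.
  split=> //; do 2![apply: config_upd => //].
  by rewrite -cell_f; apply: config_write.
have target_addr : reg s rAddr + reg s rA = 3 + a + i.
  by rewrite addnAC -addr_f; congr (_ + _); apply: (config_a conf_f).
rewrite /= /upd /= target_addr.
exact: (config_target conf_f).
Qed.

Lemma run_mark_cell c f w (i : 'I_a) m s : at_cell k p c f w i m s ->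
  at_cell k p (c - 1) (fun j => if j == i then 2 else f j) w i m
    (run mark_cell s).
Proof.
case=> conf_s addr_s count_s; split=> //.
have conf_two := config_upd conf_s (r := rCell) 2 isT.
exact: config_decr_budget (config_store conf_two rCell addr_s).
Qed.

Definition mark_budget (j : nat) : nat := b - #|(P :\: X) :&: below a j|.

Lemma run_mark_if_preferred f w (i : 'I_a) s :
  config k p (mark_budget i) f w s ->
  reg s rCell = bits X i -> reg s rCellY = bits Y i ->
  run mark_if_preferred s = if i \in M then run mark_cell s else s.
Proof.
move=> conf_s cell_s cellY_s.
rewrite in_chosen_first in_preferred -subn_gt0 -/(mark_budget i).
rewrite /= cell_s cellY_s (config_budget conf_s) (config_pref conf_s) /bits.
by case: (i \in X); case: (mark_budget i); case: (i \in Y); case: p.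
Qed.

Lemma mark_budgetS (i : 'I_a) : mark_budget i.+1 = mark_budget i - (i \in M).
Proof. exact: subn_card_belowS. Qed.

Definition mark_contents (j : nat) : 'I_a -> nat :=
  marked_bits X (M :&: below a j).

Lemma mark_contents_self (i : 'I_a) : mark_contents i i = bits X i.
Proof. by rewrite /mark_contents /marked_bits in_setI_belowx. Qed.

Lemma mark_contentsS (i : 'I_a) :
  mark_contents i.+1 =1
    if i \in M then fun j => if j == i then 2 else mark_contents i j
    else mark_contents i.
Proof.
move=> j; rewrite /mark_contents /marked_bits in_setI_belowS.
case: (eqVneq j i) => [->|ne_ji]; case: (i \in M) => //=.
- by rewrite eqxx.
- by rewrite in_setI_belowx.
- by rewrite (negbTE ne_ji).
Qed.

Definition mark_output (j : nat) : seq nat := o ++ take j (charvec X).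

Lemma load_cellsP (i : 'I_a) m :
  triple (at_cell k p (mark_budget i) (mark_contents i) (mark_output i) i m)
    load_cells (cost load_cells)
    (fun s => [/\ at_cell k p (mark_budget i) (mark_contents i)
                     (mark_output i.+1) i m s,
                  reg s rCell = bits X i & reg s rCellY = bits Y i]).
Proof.
apply: triple_run => // s /run_load_cells; rewrite mark_contents_self.
by rewrite rcons_cat -nth_charvec -take_nth ?size_charvec // nth_charvec.
Qed.

Lemma mark_if_preferredP w (i : 'I_a) m :
  triple (fun s => [/\ at_cell k p (mark_budget i) (mark_contents i) w i m s,
                       reg s rCell = bits X i & reg s rCellY = bits Y i])
    mark_if_preferred (cost mark_if_preferred)
    (at_cell k p (mark_budget i.+1) (mark_contents i.+1) w i m).
Proof.
apply: triple_run => // s [at_s cell_s cellY_s].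
have [conf_s addr_s count_s] := at_s.
rewrite (run_mark_if_preferred conf_s) // mark_budgetS.
have := mark_contentsS i; case: ifP => iM contentsS.
- have [conf_s' addr_s' count_s'] := run_mark_cell at_s.
  by split=> //; apply: (eq_config conf_s') => j; rewrite contentsS.
- rewrite subn0; split=> //.
  by apply: (eq_config conf_s) => j; rewrite contentsS.
Qed.

Lemma emit_and_markP (i : 'I_a) m :
  triple (at_cell k p (mark_budget i) (mark_contents i) (mark_output i) i m)
    emit_and_mark (cost emit_and_mark)
    (at_cell k p (mark_budget i.+1) (mark_contents i.+1) (mark_output i.+1)
       i m).
Proof.
exact: (triple_seq (@load_cellsP _ _) (@mark_if_preferredP _ _ _)).
Qed.

Lemma copy_budgetP c f w :
  triple (config k p c f w) (copy rBudget rB) (cost (copy rBudget rB))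
    (config k p b f w).
Proof. by apply: triple_run => // s [*]; split. Qed.

Definition mark_pass_cost : nat :=
  cost (copy rBudget rB) + scan_cost (cost emit_and_mark).

Lemma mark_passP c :
  triple (config k p c (bits X) o) mark_pass mark_pass_cost
    (config k p (b - #|P :\: X|) (marked_bits X M) (o ++ charvec X)).
Proof.
apply: triple_seq; first exact: copy_budgetP.
have scan_ok : triple
    (config k p (mark_budget 0) (mark_contents 0) (mark_output 0))
    (scan emit_and_mark)
    (scan_cost (cost emit_and_mark))
    (config k p (mark_budget a) (mark_contents a) (mark_output a)).
  by apply: scanP => i m; apply: emit_and_markP.
apply: triple_conseq scan_ok => s.
- rewrite /mark_budget setI_below0 cards0 subn0 /mark_output take0 cats0.
  move=> /eq_config; apply=> j.
  by rewrite /mark_contents setI_below0 /marked_bits inE.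
- rewrite /mark_budget /mark_contents /mark_output !setI_below.
  by rewrite take_oversize ?size_charvec.
Qed.

Definition update_budget (j : nat) : nat :=
  b - #|P :\: X| - #|unchosen b P X :&: below a j|.

Definition update_contents (j : nat) (i : 'I_a) : nat :=
  if i < j then bits (greedy_next b P X) i else marked_bits X M i.

Lemma in_chosen_last (i : 'I_a) :
  (i \in chosen_last b P X) = (marked_bits X M i == 0) && (0 < update_budget i).
Proof.
rewrite in_smallest -subn_gt0 in_setD in_setC -/M /marked_bits /bits.
by case: (i \in M); case: (i \in X).
Qed.

Lemma bits_greedy_next (i : 'I_a) :
  bits (greedy_next b P X) i =
  marked_bits X M i - 1 + (i \in chosen_last b P X).
Proof.
rewrite /bits in_setU -/M in_chosen_last /marked_bits /bits.
by case: (i \in M); case: (i \in X).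
Qed.

Lemma update_budgetS (i : 'I_a) :
  update_budget i.+1 = update_budget i - (i \in chosen_last b P X).
Proof. exact: subn_card_belowS. Qed.

Lemma run_choose_cell f w (i : 'I_a) m s :
  at_cell k p (update_budget i) f w i m s -> reg s rCell = marked_bits X M i ->
  at_cell k p (update_budget i.+1) f w i m (run choose_cell s) /\
  reg (run choose_cell s) rCell = bits (greedy_next b P X) i.
Proof.
rewrite update_budgetS bits_greedy_next in_chosen_last.
case=> conf_s addr_s count_s.
have [budget_s one_s] := (config_budget conf_s, config_one conf_s).
case: (marked_bits X M i) => [|v] cell_s; rewrite /= cell_s /= ?budget_s;
  last first.
  rewrite subn0 addn0 /upd /= one_s; split=> //; split=> //.
  exact: config_upd.
case: posnP => [_ | _] /=; first by rewrite subn0.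
split=> //; split=> //.
exact: config_decr_budget (config_upd conf_s (r := rCell) 1 isT).
Qed.

Lemma update_cellP w (i : 'I_a) m :
  triple (at_cell k p (update_budget i) (update_contents i) w i m)
    update_cell (cost update_cell)
    (at_cell k p (update_budget i.+1) (update_contents i.+1) w i m).
Proof.
apply: triple_run => // s /fetch_cell[at_f].
rewrite [X in _ = X -> _]/update_contents ltnn => /(run_choose_cell at_f).
case=> [[conf_c addr_c count_c] cell_c]; split=> //.
apply: (eq_config (config_store conf_c rCell addr_c)) => j.
rewrite cell_c /update_contents [in RHS]ltnS [in RHS]leq_eqVlt val_eqE.
by case: eqP => // ->.
Qed.

Lemma update_passP w :
  triple (config k p (b - #|P :\: X|) (marked_bits X M) w) update_pass
    (scan_cost (cost update_cell))
    (config k p (update_budget a) (bits (greedy_next b P X)) w).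
Proof.
have scan_ok : triple (config k p (update_budget 0) (update_contents 0) w)
    update_pass (scan_cost (cost update_cell))
    (config k p (update_budget a) (update_contents a) w).
  by apply: (@scanP _ _ _ _ (fun=> w)) => i m; apply: update_cellP.
apply: triple_conseq scan_ok => s.
- by rewrite /update_budget setI_below0 cards0 subn0.
- by move=> /eq_config; apply=> j; rewrite /update_contents ltn_ord.
Qed.

End Passes.

Section MainLoop.

Variables (n : nat) (X : {set 'I_a}).

(* The last iteration, at [i = n], also computes a successor of the last set,
   which is never written. *)
Definition walk_state (i : nat) (s : state) : Prop :=
  exists c, config (n.+1 - i) (~~ odd (n.+1 - i)) c
    (bits (greedy_walk b n X Y i))
    (flatten [seq charvec (greedy_walk b n X Y j) | j <- iota 0 i]) s.

Definition iteration_cost : nat :=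
  mark_pass_cost + (scan_cost (cost update_cell) + cost advance).

Lemma advanceP k p c f w :
  triple (config k.+1 p c f w) advance
    (cost advance) (config k (~~ p) c f w).
Proof.
apply: triple_run => // s [? ? todo_s one_s pref_s *]; split=> //=.
- by rewrite /upd /= todo_s one_s subn1.
- by rewrite /upd /= one_s pref_s; case: (p).
Qed.

Lemma walk_stepP i : i <= n ->
  triple (walk_state i) walk_step iteration_cost (walk_state i.+1).
Proof.
move=> le_in s [c]; move: s; rewrite subSn // /=.
apply: triple_seq; first exact: mark_passP.
apply: triple_seq; first exact: update_passP.
apply: (triple_conseq (fun s conf_s => conf_s) _ (@advanceP _ _ _ _ _)) => s.
rewrite !negbK => conf_s; eexists.
rewrite -[X in iota _ X]addn1 iotaD map_cat flatten_cat /= cats0 subSS.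
exact: conf_s.
Qed.

Lemma main_loopP :
  triple (walk_state 0) (While rTodo walk_step)
    (while_cost n.+1 iteration_cost) (walk_state n.+1).
Proof.
pose I m := walk_state (n.+1 - m).
apply: (@triple_conseq _ (I n.+1) _ (I 0)) => //; first by rewrite /I subnn.
apply: triple_while => [m s le_m [c /config_todo]|m lt_m].
  by rewrite subKn.
by rewrite /I subSS subSn //; apply: walk_stepP; apply: leq_subr.
Qed.

Definition parity_state (m : nat) (s : state) : Prop :=
  config n.+1 (~~ odd (n.+1 - m)) 0 (bits X) [::] s /\ reg s rCount = m.

Lemma setupP :
  triple (eq (init (encode_input b n X Y))) setup (cost setup)
    (parity_state n.+1).
Proof.
apply: triple_run => // _ <-; rewrite /parity_state subnn.
split; last by rewrite /= /upd /= add0n addn1.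
split=> //=; first by rewrite /upd /= addn1.
- by move=> i; rewrite /= nth_cat size_charvec ltn_ord nth_charvec.
- move=> i; rewrite /= nth_cat size_charvec ltnNge leq_addr /= addKn.
  exact: nth_charvec.
Qed.

Lemma parity_stepP m : m <= n ->
  triple (parity_state m.+1) parity_step
    (cost parity_step) (parity_state m).
Proof.
move=> le_mn; apply: triple_run => // s [conf_s count_s].
case: (conf_s) => ? ? ? one_s pref_s *.
split; last by rewrite /= /upd /= count_s one_s subn1.
split=> //=; rewrite /upd /= one_s pref_s subSS (subSn le_mn) /=.
by case: (odd _).
Qed.

Definition parity_loop_cost : nat :=
  while_cost n.+1 (cost parity_step).

Lemma parity_loopP :
  triple (parity_state n.+1) (While rCount parity_step)
    parity_loop_cost (parity_state 0).
Proof.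
by apply: triple_while => [m s _ []//|m]; apply: parity_stepP.
Qed.

Definition coloring_cost : nat :=
  cost setup + (parity_loop_cost + while_cost n.+1 iteration_cost).

Lemma coloring_progP :
  triple (eq (init (encode_input b n X Y))) coloring_prog coloring_cost
    (fun s => out s = encode_output (greedy_coloring b n X Y)).
Proof.
apply: triple_seq; first exact: setupP.
apply: triple_seq; first exact: parity_loopP.
apply: triple_conseq main_loopP => s [].
- by rewrite subn0 /walk_state subn0 => conf_s _; exists 0.
- move=> c /config_out ->; rewrite /encode_output -val_enum_ord -map_comp.
  by congr flatten; apply: eq_map.
Qed.

Lemma coloring_cost_linear : 0 < a -> coloring_cost <= 100 * (a * n.+1).
Proof.
move=> a_gt0.
rewrite /coloring_cost /parity_loop_cost /iteration_cost /mark_pass_cost.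
rewrite /scan_cost /while_cost /=.
nia.
Qed.

Lemma coloring_prog_computes : 0 < a ->
  computes_within coloring_prog (encode_input b n X Y)
    (encode_output (greedy_coloring b n X Y)) (100 * (a * n.+1)).
Proof.
move=> a_gt0; have [t [s [exec_s le_t out_s]]] := coloring_progP erefl.
by exists t, s; split=> //; apply: leq_trans le_t (coloring_cost_linear a_gt0).
Qed.

End MainLoop.
End Configurations.

Theorem theorem8 :
  (forall (a b e n : nat) (C0 Cn : {set 'I_a}),
      1 <= b -> 1 <= e <= b -> a = 2 * b + e ->
      good b C0 -> good b Cn -> compatible b e n%:Z C0 Cn ->
      exists phi : 'I_n.+1 -> {set 'I_a},
        [/\ ab_coloring (@path_adj n) b phi, phi ord0 = C0 & phi ord_max = Cn])
  /\
  (exists (p : prog) (c : nat),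
    forall (a b e n : nat) (C0 Cn : {set 'I_a}),
      1 <= b -> 1 <= e <= b -> a = 2 * b + e ->
      good b C0 -> good b Cn -> compatible b e n%:Z C0 Cn ->
      exists phi : 'I_n.+1 -> {set 'I_a},
        [/\ ab_coloring (@path_adj n) b phi, phi ord0 = C0, phi ord_max = Cn
          & computes_within p (encode_input b n C0 Cn) (encode_output phi)
              (c * (a * n.+1))]).
Proof.
split=> [a b e n C0 Cn _ _ def_a C0_good Cn_good C0Cn|].
  by exists (greedy_coloring b n C0 Cn); apply: greedy_coloringP C0Cn.
exists coloring_prog, 100 => a b e n C0 Cn b_gt0 _ def_a C0_good Cn_good C0Cn.
have [coloring phi0 phin] := greedy_coloringP def_a C0_good Cn_good C0Cn.
exists (greedy_coloring b n C0 Cn); split=> //.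
by apply: coloring_prog_computes; lia.
Qed.
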